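(* Let $\alpha\in\mathbb R\setminus\mathbb Q$ and let $\xi\in(0,1)$. There exists $f\in\mathcal C_0^\xi(\mathbb T)$ such that, for all $\nu\in(0,1-\xi)$, $$\dim_{\mathcal H}(\mathcal F_\nu(f))\leq\sqrt{\frac{\xi}{1-\nu}},\qquad\text{where}\quad \mathcal F_\nu(f)=\left\{x\in\mathbb T:\ \limsup_{n\to\infty}\frac{|S_{n,\alpha}f(x)|}{n^\nu}<+\infty\right\}.$$
   Context: $\mathbb T=\mathbb R/\mathbb Z$, and $|x-y|$ denotes the usual distance on $\mathbb T$. $\mathcal C_0^\xi(\mathbb T)$ is the set of real-valued functions $f$ on $\mathbb T$ with zero mean (for Lebesgue measure) for which there is a constant $C>0$ with $|f(x)-f(y)|\leq C|x-y|^\xi$ for all $x,y\in\mathbb T$. $S_{n,\alpha}f(x)=\sum_{k=0}^{n-1}f(x+k\alpha)$. $\dim_{\mathcal H}$ denotes Hausdorff dimension. *)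

(* Defs.v *)
From HB Require Import structures.
From mathcomp Require Import all_boot all_order all_algebra.
From mathcomp Require Import all_classical all_reals all_analysis.

Set Implicit Arguments.
Unset Strict Implicit.
Unset Printing Implicit Defensive.
Import Order.TTheory GRing.Theory Num.Theory.
Import numFieldNormedType.Exports.
Local Open Scope classical_set_scope.
Local Open Scope quotient_scope.
Local Open Scope ring_scope.

Section hausdorff.
Context {R : realType} {T : metricType R}.
Implicit Types (A U : set T) (s delta : R).
Local Open Scope ereal_scope.

Definition diameter U : \bar R :=
  ereal_sup [set (mdist p.1 p.2)%:E | p in U `*` U].

(* The empty set costs 0 for every exponent; this only matters for s = 0. *)
Definition hausdorff_gauge s U : \bar R :=
  if U == set0 then 0 else diameter U `^ s.

Definition hausdorff_content s delta A : \bar R :=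
  ereal_inf [set \sum_(0 <= i <oo) hausdorff_gauge s (U i) |
    U in [set U : (set T)^nat |
           A `<=` \bigcup_i U i /\ forall i, diameter (U i) <= delta%:E]].

(* The content is nonincreasing in delta, so that this supremum is its limit
   as delta tends to 0. *)
Definition hausdorff_measure s A : \bar R :=
  ereal_sup [set hausdorff_content s delta A |
    delta in [set delta | (0 < delta)%R]].

Definition hausdorff_dim A : \bar R :=
  ereal_inf [set s%:E |
    s in [set s | (0 <= s)%R /\ hausdorff_measure s A = 0]].

End hausdorff.

Definition integers (R : realType) : zmodClosed R :=
  GRing.ZmodClosed.clone R (@Num.int_num_subdef R) _.

Definition torus (R : realType) := Quotient.quot (integers R).

HB.instance Definition _ (R : realType) := GRing.Zmodule.on (torus R).

Definition torus_pi {R : realType} (a : R) : torus R := \pi_(torus R) a.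

Section torus_metric.
Context {R : realType}.
Implicit Types (x y z : torus R) (a b : R).

Definition torus_norm x : R := inf [set `|a| | a in [set a | torus_pi a = x]].

Definition torus_dist x y : R := torus_norm (x - y).

Lemma torus_piB a b : torus_pi (a - b) = torus_pi a - torus_pi b.
Proof. by rewrite /torus_pi !piE. Qed.

Lemma torus_piD a b : torus_pi (a + b) = torus_pi a + torus_pi b.
Proof. by rewrite /torus_pi !piE. Qed.

Lemma torus_piN a : torus_pi (- a) = - torus_pi a.
Proof. by rewrite /torus_pi !piE. Qed.

Lemma torus_pi0 : torus_pi 0 = 0 :> torus R.
Proof. by rewrite -(subrr (0 : R)) torus_piB subrr. Qed.

Lemma torus_piP a b : torus_pi a = torus_pi b <-> a - b \is a Num.int.
Proof.
by rewrite /torus_pi; split => [/eqP|ab]; [|apply/eqP]; rewrite -Quotient.idealrBE.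
Qed.

Lemma torus_pi_repr x : torus_pi (repr x) = x.
Proof. exact: reprK. Qed.

Let norms_inf x : has_inf [set `|a| | a in [set a | torus_pi a = x]].
Proof.
split; first by exists `|repr x|, (repr x) => //=; exact: torus_pi_repr.
by exists 0 => _ [a _ <-].
Qed.

Lemma torus_norm_le x a : torus_pi a = x -> torus_norm x <= `|a|.
Proof. by move=> ax; apply: ge_inf; [case: (norms_inf x)|exists a]. Qed.

Lemma torus_norm_lt x e : 0 < e ->
  exists2 a, torus_pi a = x & `|a| < torus_norm x + e.
Proof.
by move=> e0; have [_ [a ax <-] ae] := inf_adherent e0 (norms_inf x); exists a.
Qed.

Lemma torus_norm_ge0 x : 0 <= torus_norm x.
Proof. by apply: lb_le_inf => [|_ [a _ <-]//]; case: (norms_inf x). Qed.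

Lemma torus_distxx x : torus_dist x x = 0.
Proof.
apply/eqP; rewrite eq_le torus_norm_ge0 andbT -(normr0 R).
by apply: torus_norm_le; rewrite subrr torus_pi0.
Qed.

Lemma torus_dist_positivity x y : torus_dist x y = 0 -> x = y.
Proof.
move=> xy0; apply/eqP; rewrite -subr_eq0; apply/eqP.
have [a ax] := @torus_norm_lt (x - y) (2^-1) ltac:(by rewrite invr_gt0).
rewrite [torus_norm _]xy0 add0r => a2.
have [a0|a0] := eqVneq a 0; first by rewrite -ax a0 torus_pi0.
have [b bx] := @torus_norm_lt (x - y) `|a| ltac:(by rewrite normr_gt0).
rewrite [torus_norm _]xy0 add0r => ba.
have /torus_piP : torus_pi a = torus_pi b by rewrite ax bx.
move=> /norm_intr_ge1; case: eqVneq => [/subr0_eq ab|_ /(_ isT)].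
  by move: ba; rewrite ab ltxx.
rewrite leNgt (le_lt_trans (ler_normB _ _))// [ltRHS](splitr 1) div1r.
by rewrite ltrD// (lt_trans ba).
Qed.

Lemma torus_dist_sym x y : torus_dist x y = torus_dist y x.
Proof.
rewrite /torus_dist; suff H u : torus_norm u <= torus_norm (- u).
  apply/eqP; rewrite eq_le; have := H (x - y); have := H (y - x).
  by rewrite !opprB => -> ->.
apply/ler_addgt0Pr => e e0; have [a au /ltW] := @torus_norm_lt (- u) _ e0.
by apply: le_trans; rewrite -normrN torus_norm_le// torus_piN au opprK.
Qed.

Lemma torus_dist_triangle y x z :
  torus_dist x z <= torus_dist x y + torus_dist y z.
Proof.
apply/ler_addgt0Pr => e e0; have e2 : 0 < e / 2 by rewrite divr_gt0.
have [a ax /ltW ae] := @torus_norm_lt (x - y) _ e2.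
have [b bx /ltW be] := @torus_norm_lt (y - z) _ e2.
rewrite [e in leRHS]splitr addrACA (le_trans _ (lerD ae be))//.
rewrite (le_trans _ (ler_normD _ _))// torus_norm_le//.
by rewrite torus_piD ax bx addrA subrK.
Qed.

HB.instance Definition _ := isMetric.Build R (torus R)
  torus_distxx torus_dist_positivity torus_dist_sym torus_dist_triangle.

End torus_metric.

Section holder_birkhoff.
Context {R : realType}.
Implicit Types (f : torus R -> R) (xi alpha nu : R).

(* The Lebesgue measure of the torus is the image of that of [0, 1]. *)
Definition holder0 xi : set (torus R -> R) :=
  [set f | (\int[lebesgue_measure]_(t in `[0%R, 1%R]) (f (torus_pi t))%:E = 0)%E
    /\ exists2 C : R, 0 < C &
         forall x y, `|f x - f y| <= C * (mdist x y `^ xi)].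

Definition birkhoff_sum n alpha f (x : torus R) : R :=
  \sum_(0 <= k < n) f (x + torus_pi (k%:R * alpha)).

Definition slow_set alpha nu f : set (torus R) :=
  [set x | (limn_esup (fun n : nat =>
     (`|birkhoff_sum n alpha f x| / (n%:R `^ nu))%:E) < +oo)%E].

End holder_birkhoff.

(* Main.v *)
Require Import Defs.
From mathcomp Require Import all_boot all_order all_algebra.
From mathcomp Require Import all_classical all_reals all_analysis.
From mathcomp Require Import ring lra.
Import Order.TTheory GRing.Theory Num.Theory.
Import numFieldNormedType.Exports.
Local Open Scope classical_set_scope.
Local Open Scope ring_scope.

(** The function is f(x) = sum_i 2^-i q_i^-xi sin(2 pi q_i x), for very sparse
    integers q_i with |q_i alpha - p_i| < 1/q_i, and all its sets F_nu(f) with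
    0 < nu < 1 - xi are empty. Put theta = 2 pi (q alpha - p). Since
      2 sin(theta/2) sum_(k < M) sin(phi + k theta)
        = cos(phi - theta/2) - cos(phi - theta/2 + M theta),
    the Birkhoff sums of a single mode are bounded; but choosing M theta close
    to a quarter turn or to a half turn makes one of them at least M/16, for
    every x, with M >= q/8. If q_j is large enough with respect to the earlier
    modes, and the later q_i are large enough with respect to M, the j-th mode
    dominates, so that |S_M f| is at least of order
    2^-j q_j^-xi M >= c 2^-j q_j^(1-xi-nu) M^nu. The factor 2^-j makes the
    Hoelder estimate a plain summation, and q_j >= 2^(j^2) outweighs it. *)

(** * Dirichlet approximation *)

Lemma irrational_mul_natr_int (R : realType) (alpha : R) (n : nat) (p : int) :
  irrational alpha -> (0 < n)%N -> n%:R * alpha != p%:~R.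
Proof.
move=> irr n0; apply: contra_not_neq irr => E.
exists (p%:Q / n%:R) => //; rewrite fmorph_div /= rmorph_int rmorph_nat -E.
by rewrite mulrC mulKf// pnatr_eq0 -lt0n.
Qed.

(** Induction on [B]: for the new denominator only the two integers around [B * alpha] matter, and
    irrationality keeps both at a positive distance. This bound will force good denominators to be
    large. *)
Lemma dist_int_lb (R : realType) (alpha : R) (B : nat) : irrational alpha ->
  exists2 e : R, 0 < e & forall (n : nat) (p : int), (0 < n < B)%N ->
    e <= `|n%:R * alpha - p%:~R|.
Proof.
move=> irr; elim: B => [|B [e e0 eB]]; first by exists 1 => // n p; rewrite ltn0 andbF.
have [B0|B0] := leqP B 0.
  by exists 1 => // n p; move: B0; rewrite leqn0 => /eqP ->; case: n.
set x := B%:R * alpha; set m := Num.floor x.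
have mx : m%:~R < x.
  by rewrite lt_neqAle floor_le eq_sym irrational_mul_natr_int.
have xm : x < (m + 1)%:~R by exact: floorD1_gt.
exists (Num.min e (Num.min (x - m%:~R) ((m + 1)%:~R - x))).
  by rewrite !lt_min e0 !subr_gt0 mx.
move=> n p /andP[n0]; rewrite ltnS leq_eqVlt => /predU1P[->|nB]; last first.
  by rewrite ge_min eB// n0 nB.
rewrite !ge_min -/x; apply/orP; right.
have [pm|pm] := leP p m; apply/orP; [left|right].
  by rewrite (le_trans _ (ler_norm _))// lerB// ler_int.
by rewrite distrC (le_trans _ (ler_norm _))// lerB// ler_int lezD1.
Qed.

(** Pigeonhole: two of the [N + 1] fractional parts of [k * alpha], [k <= N], share one of the [N]
    cells of length 1/N. *)
Lemma dirichlet_approximation (R : realType) (alpha : R) (N : nat) :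
  (0 < N)%N -> exists (n : nat) (p : int),
    (0 < n <= N)%N /\ `|n%:R * alpha - p%:~R| < N%:R^-1.
Proof.
move=> N0; have N0R : 0 < N%:R :> R by rewrite ltr0n.
pose x (k : nat) : R := k%:R * alpha; pose u k := x k - (Num.floor (x k))%:~R.
have u0 k : 0 <= u k by rewrite subr_ge0 floor_le.
have u1 k : u k < 1.
  by rewrite ltrBlDl; have := floorD1_gt (x k); rewrite intrD.
have cell k : (Num.trunc (N%:R * u k) < N)%N.
  rewrite truncn_lt_nat; last by rewrite mulr_ge0// ler0n.
  by rewrite -[ltRHS]mulr1 ltr_pM2l.
pose f (k : 'I_N.+1) : 'I_N := Ordinal (cell k).
have /injectivePn[i [j ij fij]] : ~~ injectiveb f.
  by apply/injectiveP => /leq_card; rewrite !card_ord ltnn.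
wlog lij : i j ij fij / (i < j)%N.
  move=> H; have [ltij|ltji|/val_inj E] := ltngtP i j; first exact: (H i j).
    by apply: (H j i) => //; rewrite eq_sym.
  by rewrite E eqxx in ij.
exists (j - i)%N, (Num.floor (x j) - Num.floor (x i)).
split; first by rewrite subn_gt0 lij (leq_trans (leq_subr _ _))// -ltnS.
have -> : (j - i)%:R * alpha - (Num.floor (x j) - Num.floor (x i))%:~R = u j - u i.
  by rewrite /u /x natrB 1?ltnW// intrB; ring.
rewrite -(ltr_pM2l N0R) divff ?gt_eqF// -{1}(gtr0_norm N0R) -normrM mulrBr.
have /andP[a1 a2] := truncn_itv (mulr_ge0 (ltW N0R) (u0 i)).
have /andP[b1 b2] := truncn_itv (mulr_ge0 (ltW N0R) (u0 j)).
move: fij => /(congr1 val)/= E; rewrite -E in b1 b2.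
by move: a1 a2 b1 b2; rewrite -natr1 => *; rewrite ltr_norml; apply/andP; split; lra.
Qed.

(** Taking 1/N below the bound [e] of [dist_int_lb] excludes every denominator less than [B];
    moreover 1/N <= 1/q. *)
Lemma dirichlet_large_denominator (R : realType) (alpha : R) (B : nat) :
  irrational alpha -> exists (q : nat) (p : int),
    [/\ (B <= q)%N, (0 < q)%N & `|q%:R * alpha - p%:~R| < q%:R^-1].
Proof.
move=> irr; have [e e0 eB] := dist_int_lb _ _ B irr.
have [q [p [/andP[q0 qN] qp]]] := dirichlet_approximation _ alpha _ (ltn0Sn (Num.trunc e^-1)).
exists q, p; split => //; last first.
  by rewrite (lt_le_trans qp)// lef_pV2 ?posrE ?ltr0n// ler_nat.
rewrite leqNgt; apply/negP => qB.
have := eB q p; rewrite q0 qB => /(_ isT) /le_lt_trans /(_ qp).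
by rewrite ltNge invf_ple ?posrE ?ltr0n// ltW// truncnS_gt.
Qed.

(** * Rotation sums of a single mode *)

Lemma sin_lipschitz (R : realType) (a b : R) : `|sin a - sin b| <= `|a - b|.
Proof.
wlog ba : a b / b < a.
  move=> H; have [/H|/H|->] := ltgtP b a => //; last by rewrite !subrr.
  by rewrite distrC [leRHS]distrC.
have [//|c _ ->] := @MVT R sin cos b a ba (fun x _ => is_derive_sin x).
  by apply: continuous_subspaceT => x; exact: continuous_sin.
by rewrite normrM ler_piMl// cos_max.
Qed.

(** Telescoping, since 2 sin(theta/2) sin(psi) = cos(psi - theta/2) - cos(psi + theta/2). *)
Lemma sum_sinE (R : realType) (phi theta : R) (M : nat) :
  2 * sin (theta / 2) * (\sum_(0 <= k < M) sin (phi + k%:R * theta)) =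
  cos (phi - theta / 2) - cos (phi - theta / 2 + M%:R * theta).
Proof.
elim: M => [|M IH]; first by rewrite big_geq// mul0r addr0 mulr0 subrr.
rewrite big_nat_recr//= mulrDr {}IH.
set psi := phi + M%:R * theta.
have -> : phi - theta / 2 + M%:R * theta = psi - theta / 2 by rewrite /psi; ring.
have -> : phi - theta / 2 + M.+1%:R * theta = psi + theta / 2.
  by rewrite /psi -natr1; field.
by rewrite (cosB psi) (cosD psi); ring.
Qed.

Lemma norm_2sin_half_le (R : realType) (theta : R) :
  `|2 * sin (theta / 2)| <= `|theta|.
Proof.
have := sin_lipschitz _ (theta / 2) 0.
by rewrite sin0 !subr0 !normrM normfV (@ger0_norm _ 2)//; lra.
Qed.

(* If both differences were smaller than 1/4, then so would be, up to a
   constant, both |cos a| and |sin a| for a = psi + eps, against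
   cos^2 a + sin^2 a = 1. *)
Lemma cos_quarter_or_half_turn (R : realType) (psi eps : R) : `|eps| <= 2^-1 ->
  4^-1 <= `|cos psi - cos (psi + (pi / 2 + eps))| \/
  4^-1 <= `|cos psi - cos (psi + 2 * (pi / 2 + eps))|.
Proof.
move=> eps2; set a := psi + eps.
have -> : psi + (pi / 2 + eps) = a + pi / 2 by rewrite /a; ring.
have -> : psi + 2 * (pi / 2 + eps) = a + eps + pi by rewrite /a; field.
have -> : psi = a - eps by rewrite /a addrK.
rewrite cosDpihalf cosDpi !opprK cosB cosD.
have se : `|sin eps| <= 2^-1.
  by have := sin_lipschitz _ eps 0; rewrite sin0 !subr0 => /le_trans; apply.
have e1 := cos2Dsin2 eps; have a1 := cos2Dsin2 a.
move: se; rewrite ler_norml => /andP[se1 se2].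
have [|lt1] := leP 4^-1 `|_|; [by left|right].
rewrite leNgt; apply/negP; move: lt1.
rewrite !ltr_norml => /andP[h1 h2] /andP[h3 h4].
set C := cos a in a1 h1 h2 h3 h4; set S := sin a in a1 h1 h2 h3 h4.
set c := cos eps in e1 h1 h2 h3 h4; set s := sin eps in e1 se1 se2 h1 h2 h3 h4.
(* The two differences amount to [C * c + S * (1 + s)] and [2 * C * c]. As [1 + s >= 1/2], the
   bounds below end in C^2 + S^2 <= 1/48 + 9/16 < 1. *)
have cc : 3 / 4 <= c ^+ 2 by nra.
have k1 : (C * c) ^+ 2 <= 1 / 64 by nra.
have k2 : C ^+ 2 <= 1 / 48 by rewrite exprMn in k1; nra.
have k3 : (S * (1 + s)) ^+ 2 <= 9 / 64.
  have : - (3 / 8) <= S * (1 + s) <= 3 / 8 by apply/andP; split; lra.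
  by move=> /andP[]; set z := S * _; nra.
have k4 : 1 / 4 <= (1 + s) ^+ 2 by nra.
have k5 : S ^+ 2 <= 9 / 16 by rewrite exprMn in k3; nra.
lra.
Qed.

(** [N] is pi/(2 theta) rounded down, so [N] steps make nearly a quarter turn and [2 * N] steps
    nearly a half turn. Dividing 1/4 by |2 sin(theta/2)| <= theta leaves 1/(4 theta), which is at
    least M/16 because M theta <= pi < 4. Only the choice between [N] and [2 * N] depends on
    [phi]. *)
Lemma sum_sin_pos_lb (R : realType) (theta : R) : 0 < theta <= 2^-1 ->
  exists2 N : nat, pi / (2 * theta) - 1 <= N%:R &
    forall phi : R, exists2 M : nat, (N <= M <= 2 * N)%N &
      M%:R / 16 <= `|\sum_(0 <= k < M) sin (phi + k%:R * theta)|.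
Proof.
move=> /andP[t0 t2]; set x := pi / (2 * theta).
have x0 : 0 <= x by rewrite divr_ge0 ?pi_ge0// mulr_ge0// ltW.
have /andP[Nx xN] := truncn_itv x0; set N := Num.trunc x in Nx xN.
have xt : x * theta = pi / 2 by rewrite /x; field; rewrite gt_eqF.
exists N; first by move: xN; rewrite -natr1; lra.
set eps := N%:R * theta - pi / 2.
have Nt : N%:R * theta = pi / 2 + eps by rewrite /eps; ring.
have Nt1 : N%:R * theta <= pi / 2 by rewrite -xt ler_pM2r.
have Nt2 : pi / 2 < N.+1%:R * theta by rewrite -xt ltr_pM2r.
have eps2 : `|eps| <= 2^-1.
  rewrite ler_norml /eps; move: Nt2; rewrite -[N.+1%:R]natr1 (mulrDl N%:R).
  by rewrite mul1r => Nt2; apply/andP; split; lra.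
have p2 := pihalf_lt2 R.
have key phi M : (M <= 2 * N)%N ->
    4^-1 <= `|cos (phi - theta / 2) - cos (phi - theta / 2 + M%:R * theta)| ->
    M%:R / 16 <= `|\sum_(0 <= k < M) sin (phi + k%:R * theta)|.
  move=> MN; rewrite -sum_sinE normrM; set S := `|\sum_(0 <= k < M) _| => h.
  have S0 : 0 <= S by exact: normr_ge0.
  have h1 : 4^-1 <= theta * S.
    rewrite (le_trans h)// ler_wpM2r// -{2}(gtr0_norm t0).
    exact: norm_2sin_half_le.
  have h2 : M%:R * theta <= 4.
    rewrite (@le_trans _ _ ((2 * N)%:R * theta))//.
      by rewrite ler_wpM2r ?ler_nat// ltW.
    by rewrite natrM; lra.
  rewrite -(ler_pM2l t0) (le_trans _ h1)//.
  by rewrite mulrA [theta * _]mulrC; lra.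
move=> phi; have [h|h] := cos_quarter_or_half_turn _ (phi - theta / 2) eps eps2.
- exists N; first by rewrite leqnn mul2n -addnn leq_addr.
  by apply: key; [rewrite mul2n -addnn leq_addr|rewrite Nt].
- exists (2 * N)%N; first by rewrite leqnn mul2n -addnn leq_addr.
  by apply: key => //; rewrite natrM -mulrA Nt.
Qed.

(** For negative [theta], oddness of sine reduces the sum at [phi] to the one at [- phi] with angle
    |theta|. *)
Lemma sum_sin_lb (R : realType) (theta : R) : 0 < `|theta| <= 2^-1 ->
  exists2 N : nat, pi / (2 * `|theta|) - 1 <= N%:R &
    forall phi : R, exists2 M : nat, (N <= M <= 2 * N)%N &
      M%:R / 16 <= `|\sum_(0 <= k < M) sin (phi + k%:R * theta)|.
Proof.
move=> /sum_sin_pos_lb[N xN H]; exists N => //.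
have [t0|t0] := leP 0 theta; first by move: H; rewrite ger0_norm.
move=> phi; have [M MN h] := H (- phi); exists M => //.
rewrite (le_trans h)// -normrN -sumrN.
by under eq_bigr do rewrite ltr0_norm// -sinN opprD opprK mulrN opprK.
Qed.

Lemma sinD2pi_int (R : realType) (x : R) (p : int) :
  sin (x + 2 * pi * p%:~R) = sin x.
Proof.
have nat_case (y : R) (n : nat) : sin (y + 2 * pi * n%:R) = sin y.
  rewrite -[RHS](periodicn (@sinD2pi R) n); congr (sin (y + _)).
  by rewrite mulr_natr mulr_natl.
case: p => n; first exact: nat_case.
by rewrite NegzE rmorphN/= mulrN -(nat_case _ n.+1) subrK.
Qed.

(** Removing [k * p] full turns leaves a step that is small when [q * alpha] is close to [p]. *)
Lemma sin_rotationE (R : realType) (alpha x : R) (q k : nat) (p : int) :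
  sin (2 * pi * q%:R * (x + k%:R * alpha)) =
  sin (2 * pi * q%:R * x + k%:R * (2 * pi * (q%:R * alpha - p%:~R))).
Proof.
rewrite -[RHS](sinD2pi_int _ _ (k%:Z * p)); congr sin.
by rewrite intrM; ring.
Qed.

(** With [p] the floor, irrationality puts theta/2 strictly between 0 and pi, and the telescoped sum
    is at most 1/sin(theta/2). *)
Lemma rotation_sum_sin_bounded (R : realType) (alpha : R) (q : nat) :
  irrational alpha -> (0 < q)%N -> exists C : R, forall (M : nat) (x : R),
    `|\sum_(0 <= k < M) sin (2 * pi * q%:R * (x + k%:R * alpha))| <= C.
Proof.
move=> irr q0; set p := Num.floor (q%:R * alpha).
set theta := 2 * pi * (q%:R * alpha - p%:~R).
have s0 : 0 < sin (theta / 2).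
  have -> : theta / 2 = pi * (q%:R * alpha - p%:~R) by rewrite /theta; field.
  have p0 := pi_gt0 R; apply: sin_gt0_pi; rewrite pmulr_rgt0// subr_gt0.
  rewrite lt_neqAle floor_le eq_sym irrational_mul_natr_int//=.
  rewrite -[ltRHS]mulr1 ltr_pM2l// ltrBlDl.
  by have := floorD1_gt (q%:R * alpha); rewrite intrD.
exists ((sin (theta / 2))^-1) => M x.
under eq_bigr do rewrite (sin_rotationE _ _ _ _ _ p) -/theta.
have := sum_sinE _ (2 * pi * q%:R * x) theta M; set S := \sum_(0 <= k < M) _ => E.
have : `|2 * sin (theta / 2) * S| <= 2.
  rewrite E (le_trans (ler_normB _ _))//.
  by rewrite (_ : 2 = 1 + 1)//; apply: lerD; exact: cos_max.
rewrite !normrM ger0_norm// (gtr0_norm s0) -mulrA ger_pMr// => h.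
by rewrite -(ler_pM2l s0) divff ?gt_eqF.
Qed.

Lemma rotation_sum_sin_lb (R : realType) (alpha : R) (B : nat) :
  irrational alpha -> exists q N : nat,
  [/\ (B <= q)%N, (0 < q)%N, q%:R <= 8 * N%:R :> R &
    forall x : R, exists2 M : nat, (N <= M <= 2 * N)%N &
      M%:R / 16 <= `|\sum_(0 <= k < M) sin (2 * pi * q%:R * (x + k%:R * alpha))|].
Proof.
(* The threshold 16 gives |theta| <= 2 pi/16 <= 1/2 and turns N >= q/4 - 1 into N >= q/8. *)
move=> irr; have [q [p [Bq q0 qp]]] := dirichlet_large_denominator _ alpha (maxn B 16) irr.
have q0R : 0 < q%:R :> R by rewrite ltr0n.
have p0 := pi_gt0 R; have p2 := pihalf_lt2 R.
have /andP[qB q16] : (B <= q)%N && (16 <= q)%N by rewrite -geq_max.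
have q16R : 16 <= q%:R :> R by rewrite ler_nat.
set theta := 2 * pi * (q%:R * alpha - p%:~R).
have t0 : 0 < `|theta|.
  by rewrite normr_gt0 !mulf_neq0 ?(gt_eqF p0)// subr_eq0 irrational_mul_natr_int.
have tq : `|theta| * q%:R <= 2 * pi.
  rewrite /theta normrM gtr0_norm ?mulr_gt0// -mulrA -[leRHS]mulr1.
  rewrite ler_wpM2l//; first by rewrite mulr_ge0// ltW.
  by rewrite -ler_pdivlMr// div1r ltW.
have t2 : `|theta| <= 2^-1 by nra.
have [|N hN H] := sum_sin_lb _ theta; first by rewrite t0 t2.
exists q, N; split => //.
  have : q%:R / 4 <= pi / (2 * `|theta|).
    by rewrite ler_pdivlMr ?mulr_gt0//; lra.
  lra.
move=> x; have [M MN h] := H (2 * pi * q%:R * x); exists M => //.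
by under eq_bigr do rewrite (sin_rotationE _ _ _ _ _ p) -/theta.
Qed.

(** * Hausdorff dimension, upper limits and functions on the torus *)

(** Exponent 0 is already admissible: a cover by empty sets costs nothing, by the convention in
    [hausdorff_gauge]. *)
Lemma hausdorff_dim_set0 (R : realType) (T : metricType R) :
  (hausdorff_dim (set0 : set T) <= 0)%E.
Proof.
apply: ereal_inf_lbound; exists 0 => //; split => //.
apply/eqP; rewrite eq_le; apply/andP; split.
- apply/ereal_supP => _ [d d0 <-]; apply: ereal_inf_lbound.
  exists (fun=> set0); first split => // i.
    by rewrite /diameter set0X image_set0 ereal_sup0 leNye.
  by apply: eseries0 => i _ _; rewrite /hausdorff_gauge eqxx.
- apply: (@le_trans _ _ (hausdorff_content 0 1 (set0 : set T))).
    apply/ereal_infP => _ [U _ <-]; apply: nneseries_ge0 => i _ _.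
    by rewrite /hausdorff_gauge; case: ifP => // _; exact: poweR_ge0.
  by apply: ereal_sup_ubound; exists 1 => //=.
Qed.

(** The upper limit is an infimum of suprema over neighbourhoods of infinity, and each contains a
    tail, where [u] is unbounded above. *)
Lemma limn_esup_unbounded (R : realType) (u : R ^nat) :
  (forall A n0, exists2 n, (n0 <= n)%N & A <= u n) ->
  limn_esup (fun n => (u n)%:E) = +oo%E.
Proof.
move=> uA; apply/eqP; rewrite eq_le leey/=.
apply/ereal_infP => _ [V [n0 _ Vn0] <-]; rewrite leye_eq; apply/eqP.
rewrite (_ : _ @` V = [set x%:E | x in u @` V]); last by rewrite image_comp.
apply: hasNub_ereal_sup; last by exists (u n0), n0 => //; exact: Vn0 (leqnn n0).
move=> [A ubA]; have [n nn0 un] := uA (A + 1) n0.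
have : u n <= A by apply: ubA; exists n => //; exact: Vn0.
by rewrite leNgt => /negP; apply; apply: lt_le_trans un; rewrite ltrDl.
Qed.

(** For a 1-periodic [F], the choice of representative is immaterial and this is the induced
    function on the quotient. *)
Definition torus_lift {R : realType} (F : R -> R) (x : torus R) : R := F (repr x).

Section torus_lift.
Context {R : realType} (F : R -> R).
Hypothesis F_periodic : forall x (p : int), F (x + p%:~R) = F x.

Lemma torus_liftE t : torus_lift F (torus_pi t) = F t.
Proof.
have /torus_piP/intrP[p E] := torus_pi_repr (torus_pi t).
by rewrite /torus_lift -(F_periodic t p) -E subrKC.
Qed.

Lemma birkhoff_sum_torus_lift n alpha t :
  birkhoff_sum n alpha (torus_lift F) (torus_pi t) =
  \sum_(0 <= k < n) F (t + k%:R * alpha).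
Proof. by apply: eq_bigr => k _; rewrite -torus_piD torus_liftE. Qed.

(** The distance is an infimum, so for distinct points [x - y] has a representative [a] with |a| < 2
    [mdist x y]; this costs a factor 2^xi <= 2. *)
Lemma torus_lift_holder C xi : 0 <= C -> 0 < xi <= 1 ->
  (forall x y, `|F x - F y| <= C * `|x - y| `^ xi) ->
  forall x y, `|torus_lift F x - torus_lift F y| <= 2 * C * mdist x y `^ xi.
Proof.
move=> C0 /andP[xi0 xi1] FC x y.
have [->|xy] := eqVneq x y.
  by rewrite subrr normr0 !mulr_ge0// powR_ge0.
have d0 : 0 < mdist x y by rewrite mdist_gt0.
have [a ax ad] := torus_norm_lt (x - y) d0.
have -> : x = torus_pi (repr y + a) by rewrite torus_piD torus_pi_repr ax subrKC.
rewrite -{1}[y]torus_pi_repr !torus_liftE.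
rewrite torus_piD torus_pi_repr ax subrKC (le_trans (FC _ _))//.
rewrite addrAC subrr add0r mulrAC mulrC ler_wpM2r//.
rewrite (@le_trans _ _ ((2 * mdist x y) `^ xi))//.
  apply: ge0_ler_powR; rewrite ?nnegrE ?mulr_ge0 ?(ltW xi0) ?(ltW d0)//.
  by rewrite mulr_natl mulr2n ltW.
rewrite powRM ?(ltW d0)// ler_wpM2r ?powR_ge0//.
by rewrite ler1_powR// ler1n.
Qed.

(** The substitution t -> 1 - t shows that the integral equals its opposite, which also rules out
    infinite values. *)
Lemma integral_torus_lift_odd : continuous F -> (forall x, F (- x) = - F x) ->
  (\int[lebesgue_measure]_(t in `[0%R, 1%R]) (torus_lift F (torus_pi t))%:E = 0)%E.
Proof.
move=> F_cont F_odd.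
under eq_integral do rewrite torus_liftE.
have cF : {within `[0, 1], continuous F} by exact: continuous_subspaceT.
have intF : lebesgue_measure.-integrable `[0, 1] (EFin \o F).
  exact/continuous_compact_integrable/cF/segment_compact.
have F_onem t : F (unstable.onem t) = - F t.
  by rewrite -F_odd -(F_periodic (- t) 1) addrC.
have : (\int[lebesgue_measure]_(t in `[0%R, 1%R]) (F t)%:E =
        - \int[lebesgue_measure]_(t in `[0%R, 1%R]) (F t)%:E)%E.
  rewrite [LHS]integration_by_substitution_onem ?ler01 ?lexx// unstable.onem1.
  under eq_integral do rewrite F_onem EFinN.
  by rewrite integralN//; exact: integrable_add_def intF.
case: (\int[_]_(_ in _) _)%E => // r [] rN; congr EFin.
lra.
Qed.

End torus_lift.

(** * Choice of the frequencies *)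

(** [K] stands for what the earlier modes impose. Positive powers tend to infinity, so both power
    inequalities hold for every denominator beyond some threshold. *)
Lemma sparse_frequency_step (R : realType) (alpha xi K : R) (i : nat) :
  irrational alpha -> 0 < xi < 1 -> exists (q N : nat) (C : R),
  [/\ (2 ^ (i * i) <= q)%N, K <= q%:R `^ xi,
      2 ^+ i * 256 * (K + 4) <= q%:R `^ (1 - xi),
      q%:R <= 8 * N%:R :> R &
      (forall x : R, exists2 M : nat, (N <= M <= 2 * N)%N &
        M%:R / 16 <= `|\sum_(0 <= k < M) sin (2 * pi * q%:R * (x + k%:R * alpha))|) /\
      (forall (M : nat) (x : R),
        `|\sum_(0 <= k < M) sin (2 * pi * q%:R * (x + k%:R * alpha))| <= C)].
Proof.
move=> irr /andP[xi0 xi1].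
have large (X s : R) : 0 < s -> exists B : nat, forall q, (B <= q)%N -> X <= q%:R `^ s.
  move=> s0; exists (Num.trunc (`|X| `^ s^-1)).+1 => q Bq.
  rewrite (le_trans (ler_norm X))//.
  have -> : `|X| = (`|X| `^ s^-1) `^ s.
    by rewrite -powRrM mulVf ?gt_eqF// powRr1.
  apply: ge0_ler_powR; rewrite ?nnegrE ?powR_ge0 ?(ltW s0)//.
  by rewrite (le_trans (ltW (truncnS_gt _)))// ler_nat.
have [B1 HB1] := large K xi xi0.
have [|B2 HB2] := large (2 ^+ i * 256 * (K + 4)) (1 - xi); first by rewrite subr_gt0.
have [q [N [Bq q0 qN H]]] :=
  rotation_sum_sin_lb _ alpha (maxn (2 ^ (i * i)) (maxn B1 B2)) irr.
have [C HC] := rotation_sum_sin_bounded _ alpha q irr q0.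
move: Bq; rewrite !geq_max => /and3P[? ? ?].
by exists q, N, C; split => //; [exact: HB1|exact: HB2].
Qed.

(** [K i] dominates both the sums of the earlier modes, which mode [i] has to beat, and the earlier
    [N j], which keeps mode [i] harmless at the earlier times. *)
Lemma sparse_frequencies (R : realType) (alpha xi : R) :
  irrational alpha -> 0 < xi < 1 -> exists (q N : nat -> nat) (K : nat -> R),
  [/\ forall i, (2 ^ (i * i) <= q i)%N,
      forall i, K i <= (q i)%:R `^ xi,
      forall i, 2 ^+ i * 256 * (K i + 4) <= (q i)%:R `^ (1 - xi),
      forall i, (q i)%:R <= 8 * (N i)%:R :> R &
  [/\ forall i (x : R), exists2 M : nat, (N i <= M <= 2 * N i)%N &
        M%:R / 16 <=
        `|\sum_(0 <= k < M) sin (2 * pi * (q i)%:R * (x + k%:R * alpha))|,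
      forall j i, (j < i)%N -> (N j)%:R <= K i &
      forall i (M : nat) (x : R), \sum_(0 <= j < i)
        `|\sum_(0 <= k < M) sin (2 * pi * (q j)%:R * (x + k%:R * alpha))| <= K i]].
Proof.
move=> irr hxi.
pose P (p : R * nat) (r : nat * nat * R) :=
  [/\ (2 ^ (p.2 * p.2) <= r.1.1)%N, p.1 <= r.1.1%:R `^ xi,
      2 ^+ p.2 * 256 * (p.1 + 4) <= r.1.1%:R `^ (1 - xi),
      r.1.1%:R <= 8 * r.1.2%:R :> R &
      (forall x : R, exists2 M : nat, (r.1.2 <= M <= 2 * r.1.2)%N &
        M%:R / 16 <= `|\sum_(0 <= k < M) sin (2 * pi * r.1.1%:R * (x + k%:R * alpha))|) /\
      (forall (M : nat) (x : R),
        `|\sum_(0 <= k < M) sin (2 * pi * r.1.1%:R * (x + k%:R * alpha))| <= r.2)].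
have : forall p, exists r, P p r.
  move=> [K i]; have [q [N [C H]]] := sparse_frequency_step _ alpha xi K i irr hxi.
  by exists (q, N, C).
move=> /choice[g gP].
(* [K i] dominates all the data attached to the frequencies of index less than
   [i], so that the next frequency depends on [K i] and [i] only. *)
pose fix K i : R := if i is j.+1
  then K j + (g (K j, j)).1.2%:R + (g (K j, j)).2 else 0.
(* The bound applies to the empty sum [M = 0]. *)
have C0 j : 0 <= (g (K j, j)).2.
  have [_ _ _ _ [_ /(_ 0%N 0)]] := gP (K j, j).
  exact: le_trans.
have KS j : K j <= K j.+1 by rewrite /= -addrA lerDl addr_ge0.
have K0 j : 0 <= K j by elim: j => // j IH; exact: le_trans (KS j).
have Kmono i j : (i <= j)%N -> K i <= K j.
  by move=> ij; exact: (homo_leq (@lexx _ _) (@le_trans _ _) KS).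
exists (fun i => (g (K i, i)).1.1), (fun i => (g (K i, i)).1.2), K.
split; [by move=> i; case: (gP (K i, i))..|split].
- by move=> i; have [_ _ _ _ []] := gP (K i, i).
- move=> j i ji; apply: le_trans (Kmono _ _ ji).
  by rewrite /= addrAC lerDr addr_ge0.
- elim=> [|i IH] M x; first by rewrite big_geq.
  rewrite big_nat_recr//=; apply: lerD.
    by rewrite (le_trans (IH M x))// lerDl.
  by have [_ _ _ _ []] := gP (K i, i).
Qed.

(** Up to distance 1 the Lipschitz bound suffices, as t <= t^xi there; beyond it, the trivial bound
    2 does. *)
Lemma sin_holder (R : realType) (xi a b : R) : 0 < xi < 1 ->
  `|sin a - sin b| <= 2 * `|a - b| `^ xi.
Proof.
move=> /andP[xi0 xi1]; have [ab|ab] := leP `|a - b| 1.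
  rewrite (le_trans (sin_lipschitz _ _ _))//.
  have [->|ab0] := eqVneq (a - b) 0; first by rewrite normr0 mulr_ge0// powR_ge0.
  rewrite (@le_trans _ _ (`|a - b| `^ xi))//.
    by rewrite ger1_powR ?normr_gt0 ?ab0// ltW.
  by rewrite ler_peMl ?powR_ge0// ler1n.
rewrite (@le_trans _ _ 2)//.
  rewrite (le_trans (ler_normB _ _))// (_ : 2 = 1 + 1)//.
  by apply: lerD; exact: sin_max.
rewrite ler_peMr// -(powRr0 `|a - b|); apply: ler_powR; exact: ltW.
Qed.

Lemma sum_geometric_half_le (R : realType) (n : nat) :
  \sum_(0 <= i < n) 2^-1 ^+ i <= 2 :> R.
Proof.
have := @geometric_le_lim R n 1 2^-1 ler01.
rewrite invr_gt0 ltr0n gtr0_norm ?invr_gt0// invf_lt1// ltr1n => /(_ isT isT).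
rewrite (_ : 1 / (1 - 2^-1) = 2); last by field.
by apply: le_trans; rewrite /series/=; under [leRHS]eq_bigr do rewrite mul1r.
Qed.

(** * The lacunary series *)

Section lacunary_series.
Context {R : realType} (q : nat -> nat) (xi : R).
Hypotheses (q_gt0 : forall i, (0 < q i)%N) (hxi : 0 < xi < 1).

Definition lacunary_coef i : R := 2^-1 ^+ i / (q i)%:R `^ xi.

Definition lacunary_term (x : R) i := lacunary_coef i * sin (2 * pi * (q i)%:R * x).

Definition lacunary (x : R) : R := limn (series (lacunary_term x)).

Let qxi_ge1 i : 1 <= (q i)%:R `^ xi :> R.
Proof.
rewrite -[leLHS](powRr0 (q i)%:R); apply: ler_powR; last by case/andP: hxi => /ltW.
by rewrite ler1n.
Qed.

Let qxi_gt0 i : 0 < (q i)%:R `^ xi :> R.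
Proof. exact: lt_le_trans (qxi_ge1 i). Qed.

Lemma lacunary_coef_ge0 i : 0 <= lacunary_coef i.
Proof. by rewrite divr_ge0// exprn_ge0// invr_ge0. Qed.

Lemma lacunary_coef_le i : lacunary_coef i <= 2^-1 ^+ i.
Proof. by rewrite ler_pdivrMr// ler_peMr// exprn_ge0// invr_ge0. Qed.

Lemma lacunary_cvg x : series (lacunary_term x) @ \oo --> lacunary x.
Proof.
apply: normed_cvg; apply: (@series_le_cvg _ _ (geometric 1 2^-1)) => [i|i|i|].
- exact: normr_ge0.
- by rewrite /= mul1r exprn_ge0// invr_ge0.
- rewrite /= mul1r normrM ger0_norm ?lacunary_coef_ge0//.
  by rewrite (le_trans _ (lacunary_coef_le i))// ler_piMr ?lacunary_coef_ge0// sin_max.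
- by apply: is_cvg_geometric_series; rewrite gtr0_norm ?invr_gt0// invf_lt1// ltr1n.
Qed.

Lemma lacunary_periodic x (p : int) : lacunary (x + p%:~R) = lacunary x.
Proof.
congr (limn (series _)); apply/funext => i; congr (_ * _).
rewrite -[RHS](sinD2pi_int _ _ ((q i)%:Z * p)); congr sin.
by rewrite intrM; ring.
Qed.

Lemma lacunary_odd x : lacunary (- x) = - lacunary x.
Proof.
apply: (cvg_unique _ (lacunary_cvg (- x))) => //.
have -> : series (lacunary_term (- x)) = - series (lacunary_term x).
  apply/funext => n; rewrite /series/= fctE -sumrN; apply: eq_bigr => i _.
  by rewrite /lacunary_term mulrN sinN mulrN.
exact: cvgN (lacunary_cvg x).
Qed.

(** In mode [i] the factor q_i^xi from [sin_holder] cancels the one in the coefficient, leaving a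
    geometric series. The constant 4 is 2 from [sin_holder] times 2 from that series. *)
Lemma lacunary_holder x y :
  `|lacunary x - lacunary y| <= 4 * (2 * pi) `^ xi * `|x - y| `^ xi.
Proof.
have cvgd : `|series (lacunary_term x) n - series (lacunary_term y) n| @[n --> \oo]
    --> `|lacunary x - lacunary y|.
  by apply: cvg_norm; apply: cvgB; exact: lacunary_cvg.
rewrite -(cvg_lim _ cvgd)//; apply: limr_le; first exact: (cvgP _ cvgd).
near=> n.
rewrite /series/= -sumrB (le_trans (ler_norm_sum _ _ _))//.
set D := (2 * pi) `^ xi * `|x - y| `^ xi.
have D0 : 0 <= D by rewrite mulr_ge0// powR_ge0.
rewrite (@le_trans _ _ (\sum_(0 <= i < n) 2^-1 ^+ i * (2 * D)))//; last first.
  rewrite -mulr_suml (le_trans (ler_wpM2r _ (sum_geometric_half_le _ n)))//.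
    by rewrite mulr_ge0.
  by rewrite /D !mulrA; lra.
apply: ler_sum => i _; rewrite /lacunary_term -mulrBr normrM.
rewrite ger0_norm ?lacunary_coef_ge0//.
rewrite (le_trans (ler_wpM2l (lacunary_coef_ge0 i) (sin_holder _ _ _ _ hxi)))//.
rewrite -mulrBr normrM normrM gtr0_norm ?mulr_gt0 ?pi_gt0// ger0_norm//.
rewrite (powRM _ (mulr_ge0 (mulr_ge0 _ (pi_ge0 R)) _))// (powRM _ (mulr_ge0 _ (pi_ge0 R)))//.
have -> : lacunary_coef i * (2 * ((2 * pi) `^ xi * (q i)%:R `^ xi * `|x - y| `^ xi)) =
   2^-1 ^+ i * (2 * D) by rewrite /lacunary_coef /D; field; rewrite gt_eqF.
by [].
Unshelve. all: by end_near. Qed.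

Lemma lacunary_continuous : continuous lacunary.
Proof.
have /andP[xi0 _] := hxi.
move=> x; apply/cvgrPdist_le => e e0.
set C := 4 * (2 * pi) `^ xi.
have C0 : 0 < C by rewrite mulr_gt0// powR_gt0// mulr_gt0// pi_gt0.
have eC : 0 < e / C by rewrite divr_gt0.
near=> y; rewrite (le_trans (lacunary_holder _ _))// -/C mulrC -ler_pdivlMr//.
have -> : e / C = ((e / C) `^ xi^-1) `^ xi.
  by rewrite -powRrM mulVf ?gt_eqF// powRr1// ltW.
apply: ge0_ler_powR; rewrite ?nnegrE ?powR_ge0 ?(ltW xi0)//.
near: y; apply: cvgr_dist_le; [exact: cvg_id|exact: powR_gt0].
Unshelve. all: by end_near. Qed.

End lacunary_series.

(** * Growth of the rotation sums of the lacunary series *)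

Section fast_growth.
Context {R : realType} (alpha xi : R) (q N : nat -> nat) (K : nat -> R).
Hypothesis hxi : 0 < xi < 1.

Let S i M x : R := \sum_(0 <= k < M) sin (2 * pi * (q i)%:R * (x + k%:R * alpha)).

Hypotheses (q_large : forall i, (2 ^ (i * i) <= q i)%N)
  (Kq : forall i, K i <= (q i)%:R `^ xi)
  (qK : forall i, 2 ^+ i * 256 * (K i + 4) <= (q i)%:R `^ (1 - xi))
  (qN : forall i, (q i)%:R <= 8 * (N i)%:R :> R)
  (S_lb : forall i x, exists2 M : nat, (N i <= M <= 2 * N i)%N & M%:R / 16 <= `|S i M x|)
  (NK : forall j i, (j < i)%N -> (N j)%:R <= K i)
  (SK : forall i M x, \sum_(0 <= j < i) `|S j M x| <= K i).

Let q_gt0 i : (0 < q i)%N.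
Proof. by apply: leq_trans (q_large i); rewrite expn_gt0. Qed.

Let qR_gt0 i : 0 < (q i)%:R :> R.
Proof. by rewrite ltr0n. Qed.

Let qxi_gt0 i : 0 < (q i)%:R `^ xi :> R.
Proof. exact: powR_gt0. Qed.

Let b i : R := lacunary_coef q xi i.

Let b_ge0 i : 0 <= b i.
Proof. exact: lacunary_coef_ge0. Qed.

Let b_le1 i : b i <= 1.
Proof.
apply: le_trans (lacunary_coef_le q xi q_gt0 hxi i) _.
by rewrite exprn_ile1// ?invr_ge0// invf_le1// ler1n.
Qed.

Lemma partial_rotation_sum n M x :
  \sum_(0 <= k < M) series (lacunary_term q xi (x + k%:R * alpha)) n =
  \sum_(0 <= i < n) b i * S i M x.
Proof.
rewrite /series/= exchange_big_nat/=; apply: eq_bigr => i _.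
by rewrite /S mulr_sumr.
Qed.

(** Exchanges the orbit sum with the series over the modes, so that estimates on finitely many modes
    pass to the limit. *)
Lemma rotation_sum_cvg M x :
  \sum_(0 <= i < n) b i * S i M x @[n --> \oo] -->
  \sum_(0 <= k < M) lacunary q xi (x + k%:R * alpha).
Proof.
have -> : (fun n => \sum_(0 <= i < n) b i * S i M x) = (fun n =>
    \sum_(0 <= k < M) series (lacunary_term q xi (x + k%:R * alpha)) n).
  by apply/funext => n; rewrite partial_rotation_sum.
elim: M => [|M IH].
  rewrite big_geq// [X in X @ _](_ : _ = fun=> 0); first exact: cvg_cst.
  by apply/funext => n; rewrite big_geq.
rewrite big_nat_recr//= [X in X @ _](_ : _ = fun n =>
    \sum_(0 <= k < M) series (lacunary_term q xi (x + k%:R * alpha)) n +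
    series (lacunary_term q xi (x + M%:R * alpha)) n); last first.
  by apply/funext => n; rewrite big_nat_recr.
by apply: cvgD => //; exact: lacunary_cvg.
Qed.

(** For i > j the trivial bound gives |S_i| <= M <= 2 N_j <= 2 K_i <= 2 q_i^xi; the coefficient
    reduces this to 2 * 2^-i. *)
Lemma high_frequencies_le j M n x : (M <= 2 * N j)%N ->
  \sum_(j.+1 <= i < n) `|b i * S i M x| <= 4.
Proof.
move=> MN; have -> : 4 = 2 * 2 :> R by lra.
apply: (@le_trans _ _ (2 * \sum_(0 <= i < n) 2^-1 ^+ i)); last first.
  by rewrite ler_wpM2l// sum_geometric_half_le.
rewrite mulr_sumr.
apply: (@le_trans _ _ (\sum_(j.+1 <= i < n) 2 * 2^-1 ^+ i)); last first.
  have [jn|nj] := leqP j.+1 n; last first.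
    by rewrite big_geq ?(ltnW nj)// sumr_ge0.
  by rewrite (@big_cat_nat _ _ _ j.+1 0 n)//= lerDr sumr_ge0.
rewrite !big_nat; apply: ler_sum => i /andP[ji _].
rewrite normrM ger0_norm//.
have SM : `|S i M x| <= 2 * (q i)%:R `^ xi.
  apply: (@le_trans _ _ M%:R).
    rewrite (le_trans (ler_norm_sum _ _ _))// -[leRHS]mul1r.
    rewrite (le_trans (ler_sum _ (fun k _ => sin_max _)))//.
    by rewrite sumr_const_nat subn0 mul1r.
  apply: (@le_trans _ _ (2 * N j)%:R); first by rewrite ler_nat.
  by rewrite natrM ler_wpM2l// (le_trans (NK _ _ ji)).
rewrite (le_trans (ler_wpM2l (b_ge0 i) SM))//.
by rewrite /b /lacunary_coef mulrCA mulrVK// ?unitfE ?gt_eqF.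
Qed.

(** Mode [j] contributes at least b_j M/16; the lower modes (at most K_j) and the higher ones (at
    most 4) consume at most half of it. *)
Lemma rotation_sum_lacunary_lb j x : exists2 M : nat, (N j <= M <= 2 * N j)%N &
  b j * M%:R / 32 <= `|\sum_(0 <= k < M) lacunary q xi (x + k%:R * alpha)|.
Proof.
have [M /andP[NM MN] SM] := S_lb j x; exists M; first by rewrite NM.
have /cvg_norm cvgM := rotation_sum_cvg M x.
rewrite -(cvg_lim _ cvgM)//; apply: limr_ge; first exact: (cvgP _ cvgM).
near=> n; have jn : (j < n)%N by near: n; exact: nbhs_infty_gt.
rewrite (@big_cat_nat _ _ _ j 0 n) ?(ltnW jn)//= (@big_ltn _ _ _ j n)//.
set A := \sum_(0 <= i < j) _; set D := \sum_(j.+1 <= i < n) _.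
have AK : `|A| <= K j.
  rewrite (le_trans (ler_norm_sum _ _ _))// (le_trans _ (SK j M x))//.
  by apply: ler_sum => i _; rewrite normrM ger0_norm// ler_piMl.
have D4 : `|D| <= 4.
  by rewrite (le_trans (ler_norm_sum _ _ _))// high_frequencies_le.
have bS : b j * M%:R / 16 <= `|b j * S j M x|.
  by rewrite normrM ger0_norm// -mulrA ler_wpM2l.
(* The constant 256 in [qK] is this 32 times the 8 of M >= q_j/8. *)
have bK : 32 * (K j + 4) <= b j * M%:R.
  have : (q j)%:R / 8 <= M%:R :> R.
    by rewrite ler_pdivrMr// (le_trans (qN j))// mulrC ler_wpM2r// ler_nat.
  move=> /(ler_wpM2l (b_ge0 j)); apply: le_trans.
  have -> : b j * ((q j)%:R / 8) = 2^-1 ^+ j * (q j)%:R `^ (1 - xi) / 8.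
    rewrite powRB; last by rewrite (gt_eqF (qR_gt0 j)) implybT.
    by rewrite powRr1// /b /lacunary_coef; field; rewrite gt_eqF.
  rewrite ler_pdivlMr// exprVn ler_pdivlMl ?exprn_gt0//.
  by rewrite (le_trans _ (qK j))//; lra.
have := ler_normD (A + (b j * S j M x + D)) (- A - D).
rewrite (_ : _ + _ + (- A - D) = b j * S j M x); last by ring.
have := ler_normD (- A) (- D); rewrite !normrN => h1 h2.
lra.
Unshelve. all: by end_near. Qed.

(** As M >= q_j/8, the quotient is at least 2^-j q_j^eta / 256, and q_j^eta >= 4^j once j eta >= 2,
    because q_j >= 2^(j^2). *)
Lemma rotation_sum_lacunary_unbounded nu x : 0 < nu < 1 - xi ->
  forall A n0, exists2 n, (n0 <= n)%N &
  A <= `|\sum_(0 <= k < n) lacunary q xi (x + k%:R * alpha)| / n%:R `^ nu.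
Proof.
move=> /andP[nu0 nu1] A n0; have /andP[xi0 xi1] := hxi.
set eta := 1 - xi - nu; have eta0 : 0 < eta by rewrite subr_gt0.
(* The three entries ensure in turn M >= q_j/8 >= n0, q_j^eta >= 4^j, and 2^j/256 >= j/256 >= A. *)
pose j := maxn (8 * n0) (maxn (Num.trunc (2 / eta)).+1 (Num.trunc (`|A| * 256)).+1).
have jn0 : (8 * n0 <= j)%N by rewrite leq_maxl.
have jeta : 2 <= j%:R * eta.
  rewrite -ler_pdivrMr// (le_trans (ltW (truncnS_gt _)))// ler_nat.
  by rewrite /j maxnCA leq_maxl.
have jA : A * 256 <= j%:R.
  rewrite (le_trans (ler_wpM2r _ (ler_norm A)))//.
  rewrite (le_trans (ltW (truncnS_gt _)))// ler_nat.
  by rewrite /j maxnA leq_maxr.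
have qj : (j <= q j)%N.
  apply: leq_trans (q_large j); apply: leq_trans (ltnW (ltn_expl j (ltnSn 1))) _.
  by rewrite leq_exp2l//; case: (j) => // i; rewrite leq_pmulr.
have [M /andP[NM MN] h] := rotation_sum_lacunary_lb j x.
have qM : (q j)%:R / 8 <= M%:R :> R.
  by rewrite ler_pdivrMr// (le_trans (qN j))// mulrC ler_wpM2r// ler_nat.
exists M.
  rewrite -(@leq_pmul2l 8)// (leq_trans jn0)// (leq_trans qj)//.
  by rewrite -(ler_nat R) natrM; lra.
have M0 : 0 < M%:R :> R by rewrite (lt_le_trans _ qM)// divr_gt0.
have Mnu0 : 0 < M%:R `^ nu by rewrite powR_gt0.
rewrite ler_pdivlMr// (le_trans _ h)// -ler_pdivlMr//.
have -> : b j * M%:R / 32 / M%:R `^ nu = b j * M%:R `^ (1 - nu) / 32.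
  rewrite powRB; last by rewrite (gt_eqF M0) implybT.
  by rewrite powRr1 ?ltW//; field; rewrite gt_eqF.
have MQ : (q j)%:R `^ (1 - nu) / 8 <= M%:R `^ (1 - nu).
  apply: (@le_trans _ _ (((q j)%:R / 8) `^ (1 - nu))).
    rewrite powRM ?invr_ge0// ler_wpM2l ?powR_ge0//.
    by apply: ger1_powR; lra.
  by apply: ge0_ler_powR; rewrite ?nnegrE ?divr_ge0 ?(ltW M0)//; lra.
have Q2 : 2 ^+ j * 2 ^+ j <= (q j)%:R `^ eta.
  have -> : 2 ^+ j * 2 ^+ j = (2 `^ (j * 2)%:R :> R).
    by rewrite powR_mulrn// exprM expr2.
  apply: (@le_trans _ _ (2 `^ ((j * j)%:R * eta))).
    apply: ler_powR; first by rewrite ler1n.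
    by rewrite !natrM -mulrA ler_wpM2l.
  rewrite powRrM powR_mulrn//; apply: ge0_ler_powR; rewrite ?nnegrE ?exprn_ge0 ?(ltW eta0)//.
  by rewrite -natrX ler_nat.
have bQ : b j * ((q j)%:R `^ (1 - nu) / 8) = (q j)%:R `^ eta / 2 ^+ j / 8.
  have -> : 1 - nu = eta + xi by rewrite /eta; ring.
  rewrite powRD; last by rewrite (gt_eqF (qR_gt0 j)) implybT.
  rewrite /b /lacunary_coef exprVn; field.
  by rewrite !gt_eqF// exprn_gt0.
have jX : j%:R <= 2 ^+ j :> R by rewrite -natrX ler_nat ltnW// ltn_expl.
have := ler_wpM2l (b_ge0 j) MQ; rewrite bQ => k1.
have : 2 ^+ j <= (q j)%:R `^ eta / 2 ^+ j by rewrite ler_pdivlMr// exprn_gt0.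
lra.
Qed.

End fast_growth.

Theorem theorem1p6 (R : realType) (alpha xi : R)
    (halpha : irrational alpha) (hxi : 0 < xi < 1) :
  exists f : torus R -> R, holder0 xi f /\
    forall nu : R, 0 < nu < 1 - xi ->
      (hausdorff_dim (slow_set alpha nu f) <= (Num.sqrt (xi / (1 - nu)))%:E)%E.
Proof.
have [q [N [K [q_large Kq qK qN [S_lb NK SK]]]]] := sparse_frequencies _ alpha xi halpha hxi.
have q_gt0 i : (0 < q i)%N by apply: leq_trans (q_large i); rewrite expn_gt0.
have F_periodic := lacunary_periodic q xi.
exists (torus_lift (lacunary q xi)); split; first split.
- apply: integral_torus_lift_odd => //.
    exact: lacunary_continuous.
  exact: lacunary_odd.
- have C0 : 0 < 4 * (2 * pi) `^ xi by rewrite mulr_gt0// powR_gt0// mulr_gt0// pi_gt0.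
  exists (2 * (4 * (2 * pi) `^ xi)); first by rewrite mulr_gt0.
  apply: torus_lift_holder => //; first exact: ltW.
    by case/andP: hxi => -> /ltW.
  exact: lacunary_holder.
- move=> nu hnu; suff -> : slow_set alpha nu (torus_lift (lacunary q xi)) = set0.
    by rewrite (le_trans (hausdorff_dim_set0 _ _))// lee_fin sqrtr_ge0.
  rewrite -subset0 => x; rewrite /slow_set/= limn_esup_unbounded ?ltxx//.
  (* A real representative turns the Birkhoff sum on the torus into a rotation sum of the periodic
     series. *)
  move=> A n0; rewrite -[x]torus_pi_repr.
  have [n nn0 An] := rotation_sum_lacunary_unbounded alpha xi q N K hxi q_large Kq qK qN S_lb NK SK
    nu (repr x) hnu A n0.
  by exists n => //; rewrite birkhoff_sum_torus_lift.
Qed.
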